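(* If a compact Hausdorff space $L$ satisfies property ($*$), then every compact Hausdorff space $K$ containing a homeomorphic copy of $L$ satisfies $\operatorname{Ext}\big(C(K),c_0\big)\ne0$.
   Context: $C(K)$ is the Banach space of continuous real-valued functions on $K$ with the supremum norm; $\mathfrak c$ is the cardinality of the continuum (regarded as an initial ordinal). A twisted sum of Banach spaces $Y$ and $X$ is a short exact sequence $0\to Y\to Z\to X\to0$ with $Z$ a Banach space and the maps bounded linear operators; it is trivial if $Y\to Z$ admits a bounded linear left inverse. $\operatorname{Ext}(X,Y)\ne0$ means that some such twisted sum is nontrivial. A biorthogonal system in a Banach space $X$ is a family $(x_i,\gamma_i)_{i\in I}$ with $x_i\in X$, $\gamma_i\in X^*$, $\gamma_i(x_i)=1$ and $\gamma_i(x_j)=0$ for $i\ne j$; it is bounded if $\sup_i\Vert x_i\Vert<+\infty$ and $\sup_i\Vert\gamma_i\Vert<+\infty$; it is weak*-null if $\big(\gamma_i(x)\big)_{i\in I}\in c_0(I)$ for all $x\in X$. A compact Hausdorff space $K$ satisfies property ($*$) if there exist a sequence $(F_n)_{n\in\omega}$ of closed subsets of $K$ and a bounded weak*-null biorthogonal system $(f_{n,\alpha},\gamma_{n,\alpha})_{n\in\omega,\alpha\in\mathfrak c}$ in $C(K)$ such that $F_n\cap\overline{\bigcup_{m\ne n}F_m}=\emptyset$ for all $n\in\omega$ and $\operatorname{supp} f_{n,\alpha}\subset F_n$ for all $n\in\omega$, $\alpha\in\mathfrak c$, where $\operatorname{supp}$ denotes the (closed) support. *)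

(* Defs.v *)
From HB Require Import structures.
From mathcomp Require Import all_boot all_order all_algebra.
From mathcomp Require Import all_classical all_reals all_analysis.
From mathcomp Require Import lra.

Set Implicit Arguments.
Unset Strict Implicit.
Unset Printing Implicit Defensive.

Import Order.TTheory GRing.Theory Num.Theory.
Import numFieldNormedType.Exports.

Local Open Scope classical_set_scope.
Local Open Scope ring_scope.

Section supnorm.
Context {R : realType} {T : Type}.
Implicit Types f g : T -> R.

Definition supnorm f : R := sup (range (fun t => `|f t|)).

Definition sup_bounded f := has_ubound (range (fun t => `|f t|)).

Lemma supnorm_ub f t : sup_bounded f -> `|f t| <= supnorm f.
Proof. by move=> bf; apply: ub_le_sup => //; exists t. Qed.

(* M >= 0 is needed since T may be empty. *)
Lemma supnorm_le f M : 0 <= M -> (forall t, `|f t| <= M) -> supnorm f <= M.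
Proof.
move=> M0 fM; rewrite /supnorm.
have [t0|/forallNP T0] := pselect (exists t : T, True).
  have [t _] := t0; apply: ge_sup; first by exists `|f t|; exists t.
  by move=> _ [s _ <-].
suff -> : range (fun t => `|f t|) = set0 by rewrite sup0.
by apply/seteqP; split => // x [t _ _]; have := T0 t.
Qed.

Lemma supnorm_ge0 f : 0 <= supnorm f.
Proof.
have [|nS] := pselect (has_sup (range (fun t => `|f t|))); last first.
  by rewrite /supnorm sup_out.
case=> -[_ [t _ _]] bf; exact: le_trans (normr_ge0 (f t)) (supnorm_ub _ bf).
Qed.

Lemma supnormD f g : sup_bounded f -> sup_bounded g ->
  supnorm (fun t => f t + g t) <= supnorm f + supnorm g.
Proof.
move=> bf bg; apply: supnorm_le => [|t]; first by rewrite addr_ge0 ?supnorm_ge0.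
by rewrite (le_trans (ler_normD _ _))// lerD// supnorm_ub.
Qed.

Lemma supnormZ (a : R) f : sup_bounded f ->
  supnorm (fun t => a * f t) = `|a| * supnorm f.
Proof.
move=> bf; apply/eqP; rewrite eq_le; apply/andP; split.
  apply: supnorm_le => [|t]; first by rewrite mulr_ge0 ?supnorm_ge0.
  by rewrite normrM ler_wpM2l// supnorm_ub.
have [->|a0] := eqVneq a 0; first by rewrite normr0 mul0r supnorm_ge0.
rewrite -ler_pdivlMl ?normr_gt0//; apply: supnorm_le => [|t].
  by rewrite mulr_ge0 ?supnorm_ge0// invr_ge0.
rewrite ler_pdivlMl ?normr_gt0// -normrM.
apply: (@supnorm_ub (fun t => a * f t)).
case: bf => M /ubP fM; exists (`|a| * M) => _ [s _ <-].
by rewrite normrM ler_wpM2l//; apply: fM; exists s.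
Qed.

Lemma supnorm0 f : sup_bounded f -> supnorm f = 0 -> forall t, f t = 0.
Proof.
move=> bf f0 t; apply/eqP; rewrite -normr_le0 -f0; exact: supnorm_ub.
Qed.

Lemma supnorm_complete (V : normedModType R) (ev : V -> T -> R) :
  (forall u v t, ev (u - v) t = ev u t - ev v t) ->
  (forall v t, `|ev v t| <= `|v|) ->
  (forall v M, 0 <= M -> (forall t, `|ev v t| <= M) -> `|v| <= M) ->
  (forall g, (forall e, 0 < e -> exists v, forall t, `|ev v t - g t| <= e) ->
    exists v, ev v =1 g) ->
  forall F : set_system V, ProperFilter F -> cauchy F -> cvg F.
Proof.
move=> evB ev_le le_ev clos F FF /cauchy_ballP Fc.
have evc t : cvg (ev^~ t @ F).
  apply/cauchy_cvgP.
  apply: (iffLR (@cauchy_ballP R R (ev^~ t @ F) _)) => e e0.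
  rewrite near_map2; have := Fc _ e0; apply: filterS => -[u v] /=.
  by rewrite -!ball_normE /= => uv; rewrite -evB (le_lt_trans (ev_le _ _)).
pose g t : R := lim (ev^~ t @ F).
have Fg (e : R) : 0 < e -> \forall v \near F, forall t, `|ev v t - g t| <= e.
  move=> e0; have e20 : 0 < e / 2 by rewrite divr_gt0.
  near=> v => t; near F => w.
  rewrite -[ev v t](subrK (ev w t)) -addrA (le_trans (ler_normD _ _))//.
  rewrite [e]splitr lerD//.
    rewrite -evB (le_trans (ev_le _ _))// ltW//.
    have : ball v (e / 2) w by near: w; near: v; exact: (nearP_dep (Fc _ e20)).
    by rewrite -ball_normE.
  rewrite distrC ltW//; near: w.
  by have /cvgrPdist_lt/(_ _ e20) := evc t.
have [v vg] : exists v, ev v =1 g.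
  by apply: clos => e e0; near F => v; exists v; near: v; exact: Fg.
apply/cvg_ex; exists v; apply/cvgrPdist_le => e e0.
have := Fg _ e0; apply: filterS => w wg; apply: le_ev => [|t]; first exact: ltW.
by rewrite evB distrC vg.
Unshelve. all: by end_near. Qed.

End supnorm.

(* The compactness proof is a parameter: it makes the supremum norm finite. *)
Definition Cspace (R : realType) (K : topologicalType)
  (cK : compact [set: K]) : Type := continuousType K R.

Section Cspace.
Context {R : realType} {K : topologicalType} {cK : compact [set: K]}.
Local Notation C := (@Cspace R K cK).
Implicit Types f g : C.

Definition Cval (f : C) : K -> R := f.

Lemma Cval_continuous (f : C) : continuous (Cval f).
Proof. exact: cts_fun. Qed.

Lemma Cval_inj (f g : C) : Cval f =1 Cval g -> f = g.
Proof. by move=> fg; apply/continuousEP. Qed.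

Lemma Cval_bounded (f : C) : sup_bounded (Cval f).
Proof.
have : compact ((fun x => `|Cval f x|) @` [set: K]).
  apply: continuous_compact => //; apply: continuous_subspaceT => x.
  by apply: cvg_norm; exact: Cval_continuous.
move=> /compact_bounded [M [_ HM]]; exists (M + 1) => _ [x _ <-].
have := HM (M + 1) (ltr_pwDr ltr01 (lexx _)) `|Cval f x| (imageT _ _).
by move=> /=; rewrite normr_id.
Qed.

Definition Cmk (f : K -> R) (cf : continuous f) : C := mkcts cf : continuousType K R.

Lemma CmkE (f : K -> R) (cf : continuous f) : Cval (Cmk cf) = f.
Proof. by []. Qed.

Let add_cts f g : continuous (fun x => Cval f x + Cval g x).
Proof. by move=> x; apply: cvgD; exact: Cval_continuous. Qed.
Let opp_cts f : continuous (fun x => - Cval f x).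
Proof. by move=> x; apply: cvgN; exact: Cval_continuous. Qed.
Let zero_cts : continuous (fun _ : K => 0 : R).
Proof. by move=> x; exact: cvg_cst. Qed.
Let scale_cts (a : R) f : continuous (fun x => a * Cval f x).
Proof. by move=> x; apply: cvgMr; exact: Cval_continuous. Qed.

Definition Cadd f g : C := Cmk (@add_cts f g).
Definition Copp f : C := Cmk (@opp_cts f).
Definition Czero : C := Cmk zero_cts.
Definition Cscale (a : R) f : C := Cmk (@scale_cts a f).

HB.instance Definition _ := Choice.copy C (continuousType K R).

Let CaddA : associative Cadd.
Proof. by move=> f g h; apply: Cval_inj => x; exact: addrA. Qed.
Let CaddC : commutative Cadd.
Proof. by move=> f g; apply: Cval_inj => x; exact: addrC. Qed.
Let Cadd0 : left_id Czero Cadd.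
Proof. by move=> f; apply: Cval_inj => x; exact: add0r. Qed.
Let CaddN : left_inverse Czero Copp Cadd.
Proof. by move=> f; apply: Cval_inj => x; exact: addNr. Qed.

HB.instance Definition _ :=
  GRing.isZmodule.Build C CaddA CaddC Cadd0 CaddN.

Let CscaleA (a b : R) f : Cscale a (Cscale b f) = Cscale (a * b) f.
Proof. by apply: Cval_inj => x; exact: mulrA. Qed.
Let Cscale1 : left_id 1 Cscale.
Proof. by move=> f; apply: Cval_inj => x; exact: mul1r. Qed.
Let CscaleDr : right_distributive Cscale +%R.
Proof. by move=> a f g; apply: Cval_inj => x; exact: mulrDr. Qed.
Let CscaleDl f : {morph Cscale^~ f : a b / a + b}.
Proof. by move=> a b; apply: Cval_inj => x; exact: mulrDl. Qed.

HB.instance Definition _ := GRing.Zmodule_isLmodule.Build R C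
  CscaleA Cscale1 CscaleDr CscaleDl.

Let Cnorm f : R := supnorm (Cval f).

Let CnormD f g : Cnorm (f + g) <= Cnorm f + Cnorm g.
Proof. by apply: supnormD; exact: Cval_bounded. Qed.
Let CnormZ (a : R) f : Cnorm (a *: f) = `|a| * Cnorm f.
Proof. by apply: supnormZ; exact: Cval_bounded. Qed.
Let Cnorm0 f : Cnorm f = 0 -> f = 0.
Proof.
by move=> /(supnorm0 (Cval_bounded f)) f0; apply: Cval_inj => x; rewrite f0.
Qed.

HB.instance Definition _ := Lmodule_isNormed.Build R C CnormD CnormZ Cnorm0.

Lemma CnormE f : `|f| = supnorm (Cval f). Proof. by []. Qed.

Let C_complete (F : set_system C) : ProperFilter F -> cauchy F -> cvg F.
Proof.
apply: (@supnorm_complete R K C Cval) => //.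
- by move=> v t; rewrite CnormE supnorm_ub//; exact: Cval_bounded.
- by move=> v M M0 vM; rewrite CnormE supnorm_le.
move=> g gC; suff cg : continuous g by exists (Cmk cg).
move=> x; apply/cvgrPdist_le => e e0.
have e30 : 0 < e / 3 by rewrite divr_gt0.
have [v vg] := gC _ e30.
have /cvgrPdist_le /(_ _ e30) := @Cval_continuous v x.
apply: filterS => y vxy.
rewrite (_ : g x - g y = - (Cval v x - g x) + (Cval v x - Cval v y)
   + (Cval v y - g y)); last by rewrite opprB subrKA addrA subrK.
rewrite (le_trans (ler_normD _ _))//.
rewrite (_ : e = e / 3 + e / 3 + e / 3); last by lra.
by rewrite lerD// (le_trans (ler_normD _ _))// lerD// normrN.
Qed.

HB.instance Definition _ := Uniform_isComplete.Build C C_complete.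

End Cspace.

Definition in_c0 (R : realType) (I : Type) (a : I -> R) :=
  forall e : R, 0 < e -> finite_set [set i | e <= `|a i|].

Lemma in_c0_natE (R : realType) (a : nat -> R) :
  in_c0 a <-> a @ \oo --> (0 : R).
Proof.
split=> [a0|a0 e e0].
  apply/cvgr0Pnorm_lt => e e0.
  have /finite_seqP[s sE] := a0 _ e0.
  exists (\max_(n <- s) n).+1 => // n /= ns.
  rewrite ltNge; apply/negP => ean.
  have : n \in s by have : [set i | e <= `|a i|] n by []; rewrite sE.
  by move=> /(@leq_bigmax_seq _ s xpredT id n) /(_ isT); rewrite leqNgt ns.
have /cvgr0Pnorm_lt /(_ _ e0) [N _ HN] := a0.
apply: (@sub_finite_set _ _ `I_N); last exact: finite_II.
move=> n /= ean; rewrite ltnNge; apply/negP => Nn.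
by have /= := HN n Nn; rewrite ltNge ean.
Qed.

Record c0 (R : realType) (I : Type) := C0Mk {
  c0val : I -> R;
  c0valP : in_c0 c0val }.

Section c0.
Context {R : realType} {I : Type}.
Local Notation C0 := (c0 R I).
Implicit Types f g : C0.

Lemma c0val_inj (f g : C0) : c0val f =1 c0val g -> f = g.
Proof.
case: f g => [f fP] [g gP] /= /funext fg; rewrite fg in fP *.
by congr C0Mk; exact: Prop_irrelevance.
Qed.

Let add_c0 f g : in_c0 (fun i => c0val f i + c0val g i).
Proof.
move=> e e0; have e20 : 0 < e / 2 by rewrite divr_gt0.
apply: (@sub_finite_set _ _ ([set i | e / 2 <= `|c0val f i|] `|`
  [set i | e / 2 <= `|c0val g i|])); last first.
  by rewrite finite_setU; split; exact: c0valP.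
move=> i /= efg; apply/orP; rewrite -implyNb -ltNge; apply/implyP => fi.
rewrite leNgt; apply/negP => gi; move: efg; rewrite leNgt => /negP; apply.
by rewrite (le_lt_trans (ler_normD _ _))// [e]splitr ltrD.
Qed.
Let opp_c0 f : in_c0 (fun i => - c0val f i).
Proof.
move=> e e0; apply: sub_finite_set (c0valP f e0) => i /=.
by rewrite normrN.
Qed.
Let zero_c0 : in_c0 (fun _ : I => 0 : R).
Proof.
move=> e e0; apply: sub_finite_set (finite_set0 I) => i /=.
by rewrite normr0 leNgt e0.
Qed.
Let scale_c0 (a : R) f : in_c0 (fun i => a * c0val f i).
Proof.
move=> e e0; have [->|a0] := eqVneq a 0.
  apply: sub_finite_set (finite_set0 I) => i /=.
  by rewrite mul0r normr0 leNgt e0.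
have ea : 0 < `|a|^-1 * e by rewrite mulr_gt0 ?invr_gt0 ?normr_gt0.
apply: sub_finite_set (c0valP f ea) => i /=.
by rewrite normrM ler_pdivrMl ?normr_gt0.
Qed.

Definition c0add f g : C0 := C0Mk (@add_c0 f g).
Definition c0opp f : C0 := C0Mk (@opp_c0 f).
Definition c0zero : C0 := C0Mk zero_c0.
Definition c0scale (a : R) f : C0 := C0Mk (@scale_c0 a f).

HB.instance Definition _ := gen_eqMixin C0.
HB.instance Definition _ := gen_choiceMixin C0.

Let c0addA : associative c0add.
Proof. by move=> f g h; apply: c0val_inj => x; exact: addrA. Qed.
Let c0addC : commutative c0add.
Proof. by move=> f g; apply: c0val_inj => x; exact: addrC. Qed.
Let c0add0 : left_id c0zero c0add.
Proof. by move=> f; apply: c0val_inj => x; exact: add0r. Qed.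
Let c0addN : left_inverse c0zero c0opp c0add.
Proof. by move=> f; apply: c0val_inj => x; exact: addNr. Qed.

HB.instance Definition _ :=
  GRing.isZmodule.Build C0 c0addA c0addC c0add0 c0addN.

Let c0scaleA (a b : R) f : c0scale a (c0scale b f) = c0scale (a * b) f.
Proof. by apply: c0val_inj => x; exact: mulrA. Qed.
Let c0scale1 : left_id 1 c0scale.
Proof. by move=> f; apply: c0val_inj => x; exact: mul1r. Qed.
Let c0scaleDr : right_distributive c0scale +%R.
Proof. by move=> a f g; apply: c0val_inj => x; exact: mulrDr. Qed.
Let c0scaleDl f : {morph c0scale^~ f : a b / a + b}.
Proof. by move=> a b; apply: c0val_inj => x; exact: mulrDl. Qed.

HB.instance Definition _ := GRing.Zmodule_isLmodule.Build R C0
  c0scaleA c0scale1 c0scaleDr c0scaleDl.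

Let c0norm f : R := supnorm (c0val f).

Lemma c0val_bounded (f : C0) : sup_bounded (c0val f).
Proof.
have fin := finite_image (fun i => `|c0val f i|) (c0valP f ltr01).
have [M HM] : has_ubound ((fun i => `|c0val f i|) @` [set i | 1 <= `|c0val f i|]).
  have /compact_bounded [M [_ HM]] := finite_compact fin.
  exists (M + 1) => _ [i Hi <-].
  have := HM (M + 1) (ltr_pwDr ltr01 (lexx _)) `|c0val f i|.
  by move=> /=; rewrite normr_id; apply; exists i.
exists (Num.max M 1) => _ [i _ <-]; rewrite le_max.
have [fi1|fi1] := lerP 1 `|c0val f i|; last by rewrite (ltW fi1) orbT.
by rewrite HM//; exists i.
Qed.

Let c0normD f g : c0norm (f + g) <= c0norm f + c0norm g.
Proof. by apply: supnormD; exact: c0val_bounded. Qed.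
Let c0normZ (a : R) f : c0norm (a *: f) = `|a| * c0norm f.
Proof. by apply: supnormZ; exact: c0val_bounded. Qed.
Let c0norm0 f : c0norm f = 0 -> f = 0.
Proof.
by move=> /(supnorm0 (c0val_bounded f)) f0; apply: c0val_inj => x; rewrite f0.
Qed.

HB.instance Definition _ := Lmodule_isNormed.Build R C0 c0normD c0normZ c0norm0.

Lemma c0normE f : `|f| = supnorm (c0val f). Proof. by []. Qed.

Let c0_complete (F : set_system C0) : ProperFilter F -> cauchy F -> cvg F.
Proof.
apply: (@supnorm_complete R I C0 (@c0val R I)) => //.
- by move=> v t; rewrite c0normE supnorm_ub//; exact: c0val_bounded.
- by move=> v M M0 vM; rewrite c0normE supnorm_le.
move=> g gC; suff cg : in_c0 g by exists (C0Mk cg).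
move=> e e0; have e20 : 0 < e / 2 by rewrite divr_gt0.
have [v vg] := gC _ e20.
apply: sub_finite_set (c0valP v e20) => i /= egi.
rewrite leNgt; apply/negP => vi.
move: egi; rewrite leNgt => /negP; apply.
rewrite -[g i](subrK (c0val v i)) (le_lt_trans (ler_normD _ _))//.
by rewrite [e]splitr ler_ltD// distrC.
Qed.

HB.instance Definition _ := Uniform_isComplete.Build C0 c0_complete.

End c0.

Section twisted_sums.
Context {R : realType}.

Definition twisted_sum (Y Z X : completeNormedModType R)
    (i : {linear Y -> Z}) (q : {linear Z -> X}) :=
  [/\ continuous i, continuous q, injective i,
      range i = [set z | q z = 0] & range q = [set: X]].

Definition trivial_twisted_sum (Y Z : completeNormedModType R)
    (i : {linear Y -> Z}) :=
  exists r : {linear Z -> Y}, continuous r /\ cancel i r.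

Definition Ext_neq0 (X Y : completeNormedModType R) :=
  exists (Z : completeNormedModType R)
         (i : {linear Y -> Z}) (q : {linear Z -> X}),
    twisted_sum i q /\ ~ trivial_twisted_sum i.

End twisted_sums.

Section biorthogonal.
Context {R : realType} {X : normedModType R} {I : Type}.
Implicit Types (x : I -> X) (g : I -> {linear X -> R}).

(* For h linear and continuous the set is bounded; otherwise sup may be the
   default value 0. *)
Definition opnorm (h : X -> R) : R :=
  sup [set `|h v| | v in [set v | `|v| <= 1]].

Definition biorthogonal x g :=
  [/\ forall i, continuous (g i), forall i, g i (x i) = 1
    & forall i j, i <> j -> g i (x j) = 0].

Definition biorthogonal_bounded x g :=
  has_ubound (range (fun i => `|x i|)) /\
  has_ubound (range (fun i => opnorm (g i))).

Definition weak_star_null g := forall v : X, in_c0 (fun i => g i v).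

End biorthogonal.

Definition closed_support (R : realType) (K : topologicalType) (f : K -> R) :=
  closure [set t | f t != 0].

(* An index set of cardinality 2^aleph_0; the order of the ordinal is not used. *)
Definition continuum : Type := nat -> bool.

Definition property_star (R : realType) (K : topologicalType)
    (cK : compact [set: K]) :=
  exists (F : nat -> set K)
         (f : nat * continuum -> Cspace R cK)
         (g : nat * continuum -> {linear Cspace R cK -> R}),
    [/\ forall n, closed (F n),
        biorthogonal f g,
        biorthogonal_bounded f g & weak_star_null g] /\
    [/\ forall n, F n `&` closure (\bigcup_(m in [set m | m <> n]) F m) = set0
      & forall n a, closed_support (Cval (f (n, a))) `<=` F n].

Definition homeomorphic (X Y : topologicalType) :=
  exists (h : X -> Y) (k : Y -> X),
    [/\ continuous h, continuous k, cancel h k & cancel k h].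

(* A : set K is coerced to the subtype of K, with the subspace topology. *)
Definition contains_copy (K L : topologicalType) :=
  exists A : set K, homeomorphic L A.

(* Main.v *)
From HB Require Import structures.
Require Import Defs.
From mathcomp Require Import all_boot all_order all_algebra.
From mathcomp Require Import all_classical all_reals all_analysis.
From mathcomp Require Import ring lra.

(** Pick an almost disjoint family [A a] of subsets of [nat] and a map [nu],
    both indexed by the continuum, such that no sequence [B n] of sets with
    bounded overlaps satisfies [A a `<=` B (nu a)] up to a finite set for all
    [a].  Using only the pairs of index [(nu a, a)] of a weak*-null biorthogonal
    system [(f, g)] of a Banach space [X], the operator
    [x |-> class of (\sum_a g (nu a, a) x *: 1_(A a))] from [X] to [l_oo / c_0]
    pulls the extension [c_0 -> l_oo -> l_oo / c_0] back to a twisted sum of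
    [c_0] and [X].  A splitting of it yields uniformly bounded functionals
    [sigma p] on [X] with [sigma p (f (nu a, a)) >= 1/2] for almost all [p] in
    [A a].  By the choice of [A] and [nu], for every [N] some [p] is such that
    [sigma p (f (n, a n)) >= 1/2] for all [n < N] and suitable [a n], which is
    absurd if the sums of the [f (n, a n)] are uniformly bounded.  For [C(K)],
    these sums become bounded after extending the given functions from [L] to
    [K] and multiplying the [n]-th ones by [phi n], where [phi n] is
    nonnegative, equals [1] on [F n], and [\sum_n phi n <= 1]. *)

Set Implicit Arguments.
Unset Strict Implicit.
Unset Printing Implicit Defensive.

Import Order.TTheory GRing.Theory Num.Theory.
Import numFieldNormedType.Exports.
Local Open Scope classical_set_scope.
Local Open Scope ring_scope.

(** * Almost disjoint families and the diagonal argument *)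

Definition almost_disjoint (I : Type) (A : I -> set nat) :=
  forall a b, a <> b -> finite_set (A a `&` A b).

(** The path of [a] in the binary tree, whose nodes are coded by natural numbers. *)
Definition branch (a : continuum) : set nat :=
  range (fun k => pickle (mkseq a k)).

Lemma pickle_mkseq_inj (a b : continuum) k l :
  pickle (mkseq a k) = pickle (mkseq b l) -> k = l /\ mkseq a k = mkseq b l.
Proof.
move=> /(pcan_inj pickleK) e; split=> //.
by have := congr1 size e; rewrite !size_mkseq.
Qed.

Lemma branch_infinite a : infinite_set (branch a).
Proof.
rewrite /branch (eq_finite_set (inj_card_eq _)); first exact: infinite_nat.
by move=> k l _ _ /pickle_mkseq_inj [].
Qed.

(** A common point codes a common initial segment, whose length is at most any place [n] where [a]
    and [b] differ. *)
Lemma branch_almost_disjoint : almost_disjoint branch.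
Proof.
move=> a b ab.
have [n abn] : exists n, a n <> b n.
  by apply/existsNP => ab'; apply: ab; exact/funext.
apply: (@sub_finite_set _ _ ((fun k => pickle (mkseq a k)) @` `I_n.+1)); last first.
  exact/finite_image/finite_II.
move=> _ [[k _ <-] [l _ /esym/pickle_mkseq_inj [kl]]].
rewrite -{l}kl => e; exists k => //=; rewrite ltnS leqNgt; apply/negP => nk.
by apply: abn; rewrite -[LHS](nth_mkseq false a nk) e nth_mkseq.
Qed.

(** Lets the continuum index all sequences of subsets of [nat], the candidates for [B] in the
    diagonal argument. *)
Definition decode (a : continuum) (n : nat) : set nat :=
  [set p | a (pickle (n, p))].

Lemma decode_surj (B : nat -> set nat) : exists a, decode a = B.
Proof.
exists (fun m => if unpickle m is Some (n, p) then `[< B n p >] else false).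
apply/funext => n; apply/seteqP; split => p; rewrite /decode /= pickleK.
  exact: asboolW.
exact: asboolT.
Qed.

(* A diagonal argument: if some set decoded from [a] fails to almost contain
   the branch [a], keep only the part of the branch outside that set. *)
Lemma unseparated_family :
  exists (A : continuum -> set nat) (nu : continuum -> nat),
    almost_disjoint A /\
    forall B : nat -> set nat, (forall a, finite_set (A a `\` B (nu a))) ->
    forall N, exists p, forall n, (n < N)%N -> B n p.
Proof.
have nuP a : exists n, (exists m, infinite_set (branch a `\` decode a m)) ->
    infinite_set (branch a `\` decode a n).
  by have [[m am]|am] := pselect (exists m, infinite_set (branch a `\` decode a m));
    [exists m|exists 0%N].
have [nu nuE] := choice nuP.
exists (fun a => branch a `\` decode a (nu a)), nu; split.
  move=> a b ab; apply: sub_finite_set (branch_almost_disjoint ab).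
  by move=> p [[? _] [? _]].
(* As [a] codes [B] itself, [A a] is the branch minus [B (nu a)], and the hypothesis makes it
   finite. By the choice of [nu], every [B n] then almost contains the infinite branch, so finitely
   many of them share a point of it. *)
move=> B AB N; have [a aB] := decode_surj B.
have fB n : finite_set (branch a `\` B n).
  apply: contrapT => infn.
  have /nuE inf : exists m, infinite_set (branch a `\` decode a m).
    by exists n; rewrite aB.
  apply: inf; have := AB a; rewrite aB; apply: sub_finite_set.
  by move=> p [].
have fU : finite_set (\bigcup_(n in `I_N) (branch a `\` B n)).
  by apply: bigcup_finite => //; exact: finite_II.
have /infinite_setN0 [p [ap pB]] := infinite_setD (@branch_infinite a) fU.
exists p => n nN; apply: contrapT => nB; apply: pB; by exists n.
Qed.

(** * The pull-back twisted sum as a Banach space *)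

Section in_c0.
Context {R : realType} {I : Type}.
Implicit Types f g : I -> R.

Lemma in_c0D f g : in_c0 f -> in_c0 g -> in_c0 (fun i => f i + g i).
Proof. by move=> cf cg; exact: c0valP (C0Mk cf + C0Mk cg). Qed.

Lemma in_c0Z (a : R) f : in_c0 f -> in_c0 (fun i => a * f i).
Proof. by move=> cf; exact: c0valP (a *: C0Mk cf). Qed.

Lemma in_c0N f : in_c0 f -> in_c0 (fun i => - f i).
Proof. by move=> cf; exact: c0valP (- C0Mk cf). Qed.

Lemma eq_in_c0 f g : f =1 g -> in_c0 f -> in_c0 g.
Proof. by move=> /funext ->. Qed.

End in_c0.

(** Expresses, without forming the quotient, that [Phi] induces a bounded linear operator from [X]
    to [l_oo / c_0]. *)
Record c0_linear (R : realType) (X : normedModType R) (Phi : X -> nat -> R) := {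
  c0_linear_bound : exists2 M, 0 <= M & forall x p, `|Phi x p| <= M * `|x|;
  c0_linearD : forall x y, in_c0 (fun p => Phi (x + y) p - (Phi x p + Phi y p));
  c0_linearZ : forall a x, in_c0 (fun p => Phi (a *: x) p - a * Phi x p) }.

Lemma c0_linear0 (R : realType) (X : normedModType R) (Phi : X -> nat -> R) p :
  c0_linear Phi -> Phi 0 p = 0.
Proof.
case=> -[M _ PhiM] _ _; have := PhiM 0 p.
by rewrite normr0 mulr0 normr_le0 => /eqP.
Qed.

(* The pull-back of [c_0 -> l_oo -> l_oo / c_0] along the operator induced by
   [Phi]: pairs of [x] and a sequence equal to [Phi x] modulo [c_0]. *)
Record twist (R : realType) (X : normedModType R) (Phi : X -> nat -> R)
    (linPhi : c0_linear Phi) := Twist {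
  base : X;
  fiber : nat -> R;
  fiberP : in_c0 (fun p => fiber p - Phi base p) }.

Arguments base {R X Phi linPhi} _.
Arguments fiber {R X Phi linPhi} _ _.

Section twist.
Context {R : realType} {X : normedModType R} {Phi : X -> nat -> R}.
Context {linPhi : c0_linear Phi}.
Local Notation Z := (twist linPhi).
Implicit Types u v w : Z.

Lemma twist_inj u v : base u = base v -> fiber u =1 fiber v -> u = v.
Proof.
case: u v => [x z uP] [y w vP] /= xy /funext zw; subst y w.
by congr Twist; exact: Prop_irrelevance.
Qed.

Let add_subproof u v :
  in_c0 (fun p => (fiber u p + fiber v p) - Phi (base u + base v) p).
Proof.
apply: eq_in_c0 (in_c0D (in_c0D (fiberP u) (fiberP v))
  (in_c0N (c0_linearD linPhi (base u) (base v)))) => p /=; by ring.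
Qed.
Let scale_subproof (a : R) u :
  in_c0 (fun p => (a * fiber u p) - Phi (a *: base u) p).
Proof.
apply: eq_in_c0 (in_c0D (in_c0Z a (fiberP u))
  (in_c0N (c0_linearZ linPhi a (base u)))) => p /=; by ring.
Qed.
Let opp_subproof u : in_c0 (fun p => (- fiber u p) - Phi (- base u) p).
Proof.
by have := scale_subproof (-1) u; rewrite scaleN1r; apply: eq_in_c0 => p;
  rewrite mulN1r.
Qed.
Let zero_subproof : in_c0 (fun p => 0 - Phi 0 p).
Proof.
by apply: eq_in_c0 (c0valP (0 : c0 R nat)) => p; rewrite (c0_linear0 p linPhi) subrr.
Qed.

Definition twist_add u v : Z := Twist linPhi (add_subproof u v).
Definition twist_opp u : Z := Twist linPhi (opp_subproof u).
Definition twist_zero : Z := Twist linPhi zero_subproof.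
Definition twist_scale (a : R) u : Z := Twist linPhi (scale_subproof a u).

HB.instance Definition _ := gen_eqMixin Z.
HB.instance Definition _ := gen_choiceMixin Z.

Let addA : associative twist_add.
Proof. by move=> u v w; apply: twist_inj => [|p] /=; rewrite addrA. Qed.
Let addC : commutative twist_add.
Proof. by move=> u v; apply: twist_inj => [|p] /=; rewrite addrC. Qed.
Let add0 : left_id twist_zero twist_add.
Proof. by move=> u; apply: twist_inj => [|p] /=; rewrite add0r. Qed.
Let addN : left_inverse twist_zero twist_opp twist_add.
Proof. by move=> u; apply: twist_inj => [|p] /=; rewrite addNr. Qed.

HB.instance Definition _ := GRing.isZmodule.Build Z addA addC add0 addN.

Let scaleA (a b : R) u : twist_scale a (twist_scale b u) = twist_scale (a * b) u.
Proof. by apply: twist_inj => [|p] /=; rewrite ?scalerA ?mulrA. Qed.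
Let scale1 : left_id 1 twist_scale.
Proof. by move=> u; apply: twist_inj => [|p] /=; rewrite ?scale1r ?mul1r. Qed.
Let scaleDr : right_distributive twist_scale +%R.
Proof. by move=> a u v; apply: twist_inj => [|p] /=; rewrite ?scalerDr ?mulrDr. Qed.
Let scaleDl u : {morph twist_scale^~ u : a b / a + b}.
Proof. by move=> a b; apply: twist_inj => [|p] /=; rewrite ?scalerDl ?mulrDl. Qed.

HB.instance Definition _ := GRing.Zmodule_isLmodule.Build R Z
  scaleA scale1 scaleDr scaleDl.

Lemma fiber_bounded u : sup_bounded (fiber u).
Proof.
have [M M0 PhiM] := c0_linear_bound linPhi.
have [N /ubP uN] := c0val_bounded (C0Mk (fiberP u)).
exists (N + M * `|base u|) => _ [p _ <-].
rewrite -(subrK (Phi (base u) p) (fiber u p)) (le_trans (ler_normD _ _))//.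
by rewrite lerD//; apply: uN; exists p.
Qed.

Let twist_norm u : R := Num.max `|base u| (supnorm (fiber u)).

Let normD u v : twist_norm (u + v) <= twist_norm u + twist_norm v.
Proof.
rewrite /twist_norm ge_max; apply/andP; split.
  by rewrite (le_trans (ler_normD _ _))// lerD// le_max lexx.
rewrite (le_trans (supnormD (fiber_bounded u) (fiber_bounded v)))//.
by rewrite lerD// le_max lexx orbT.
Qed.
Let normZ (a : R) u : twist_norm (a *: u) = `|a| * twist_norm u.
Proof.
rewrite /twist_norm maxr_pMr//=; congr Num.max; first exact: normrZ.
exact/supnormZ/fiber_bounded.
Qed.
Let norm0 u : twist_norm u = 0 -> u = 0.
Proof.
move=> u0; have := lexx (twist_norm u); rewrite {2}u0 /twist_norm ge_max.
move=> /andP[]; rewrite normr_le0 => /eqP bu0 su0; apply: twist_inj => //= p.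
apply: supnorm0 (fiber_bounded u) _ p; apply/eqP.
by rewrite eq_le su0 supnorm_ge0.
Qed.

HB.instance Definition _ := Lmodule_isNormed.Build R Z normD normZ norm0.

Lemma twist_normE u : `|u| = Num.max `|base u| (supnorm (fiber u)).
Proof. by []. Qed.

Lemma base_le u : `|base u| <= `|u|.
Proof. by rewrite twist_normE le_max lexx. Qed.

Lemma fiber_le u p : `|fiber u p| <= `|u|.
Proof.
by rewrite twist_normE le_max supnorm_ub ?orbT//; exact: fiber_bounded.
Qed.

Lemma twist_norm_le u M :
  `|base u| <= M -> (forall p, `|fiber u p| <= M) -> `|u| <= M.
Proof.
move=> uM fM; rewrite twist_normE ge_max uM supnorm_le//.
exact: le_trans uM.
Qed.

End twist.

Section twist_complete.
Context {R : realType} {X : completeNormedModType R} {Phi : X -> nat -> R}.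
Context {linPhi : c0_linear Phi}.
Local Notation Z := (twist linPhi).

Let twist_complete (F : set_system Z) : ProperFilter F -> cauchy F -> cvg F.
Proof.
move=> FF /cauchy_ballP Fc.
have cvgF (Y : completeNormedModType R) (h : Z -> Y) :
    (forall u v, `|h u - h v| <= `|u - v|) -> cvg (h @ F).
  move=> hlip; apply/cauchy_cvgP/cauchy_ballP => e e0.
  rewrite near_map2; have := Fc _ e0; apply: filterS => -[u v] /=.
  by rewrite -!ball_normE /= => uv; rewrite (le_lt_trans (hlip _ _)).
have cb : cvg ((base : Z -> X) @ F) by apply: cvgF => u v; exact: (base_le (u - v)).
have cf p : cvg ((fun u : Z => fiber u p) @ F).
  by apply: (@cvgF R) => u v; exact: (fiber_le (u - v) p).
pose x := lim ((base : Z -> X) @ F).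
pose z p : R := lim ((fun u : Z => fiber u p) @ F).
have Fx (e : R) : 0 < e -> \forall u \near F, `|x - base u| <= e.
  by move=> e0; move/cvgrPdist_le : cb; exact.
have Fz (e : R) : 0 < e -> \forall u \near F, forall p, `|z p - fiber u p| <= e.
  move=> e0; have e20 : 0 < e / 2 by rewrite divr_gt0.
  (* The auxiliary [v] may depend on [p] while the condition on [u] does not, so the convergence is
     uniform in [p]. *)
  near=> u => p; near F => v.
  rewrite -[z p](subrK (fiber v p)) -addrA (le_trans (ler_normD _ _))//.
  rewrite [e]splitr lerD//.
    by near: v; move/cvgrPdist_le : (cf p); exact.
  rewrite (le_trans (fiber_le (v - u) p))// distrC ltW//.
  have : ball u (e / 2) v by near: v; near: u; exact: (nearP_dep (Fc _ e20)).
  by rewrite -ball_normE.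
have zc : in_c0 (fun p => z p - Phi x p).
  have [M M0 PhiM] := c0_linear_bound linPhi.
  (* The errors [d] from the fiber and [d * M] from [Phi (x - base u)] add up to [e / 4]; the
     remaining term is in [c_0], hence below [e / 2] at almost all [p]. *)
  move=> e e0; pose d := e / (4 * (M + 1)).
  have d0 : 0 < d by rewrite divr_gt0// mulr_gt0// ltr_wpDl.
  have [u [xu zu]] : exists u : Z,
      `|x - base u| <= d /\ forall p, `|z p - fiber u p| <= d.
    near F => u; exists u; split; near: u; [exact: Fx|exact: Fz].
  have e20 : 0 < e / 2 by rewrite divr_gt0.
  have := in_c0D (fiberP u) (in_c0N (c0_linearD linPhi (x - base u) (base u))).
  move=> /(_ _ e20); apply: sub_finite_set => p /=; rewrite subrK => ep.
  rewrite leNgt; apply/negP => lep; move: ep; rewrite leNgt => /negP; apply.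
  have -> : z p - Phi x p = (z p - fiber u p) + (fiber u p - Phi (base u) p
    - (Phi x p - (Phi (x - base u) p + Phi (base u) p))) - Phi (x - base u) p.
    by ring.
  have dE : d * (M + 1) = e / 4.
    by rewrite /d; field; rewrite gt_eqF// ltr_wpDl.
  have : `|Phi (x - base u) p| <= d * M.
    by rewrite (le_trans (PhiM _ _))// mulrC ler_wpM2r.
  move: (zu p) lep.
  set a := z p - _; set b := _ - (_ - _); set c := Phi _ _ => ad be cd.
  rewrite (le_lt_trans (ler_normB _ _))// (le_lt_trans (lerD (ler_normD _ _) cd))//.
  by lra.
apply/cvg_ex; exists (Twist linPhi zc); apply/cvgrPdist_le => e e0.
near=> u; apply: twist_norm_le => [|p] /=; first by near: u; exact: Fx.
by move: p; near: u; exact: Fz.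
Unshelve. all: by end_near. Qed.

HB.instance Definition _ := Uniform_isComplete.Build Z twist_complete.

End twist_complete.

(** * A lifting that is linear modulo [c_0] *)

Section spread.
Context {R : realType} {I : Type} (A : I -> set nat).
Implicit Types (y z : I -> R) (p : nat) (a b : I).

(* The factor 2 makes such an index exist without a maximum being attained. *)
Definition dominant y p a := A a p /\ forall b, A b p -> `|y b| <= 2 * `|y a|.

(* A nonlinear lifting to bounded sequences of the operator from [c_0(I)] to
   [l_oo / c_0] that maps the unit vector at [a] to the class of the indicator
   of [A a]. *)
Definition spread y p : R :=
  if pselect (exists a, dominant y p a) is left ex then y (projT1 (cid ex))
  else 0.

(** For bounded [y], an index whose value exceeds half of the supremum over the sets containing [p]
    is dominant; if this supremum is 0, any such index is. *)
Lemma spreadP y p : sup_bounded y ->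
  (exists2 a, dominant y p a & spread y p = y a) \/
  (forall a, ~ A a p) /\ spread y p = 0.
Proof.
rewrite /spread => by_; case: pselect => [ex|nex].
  by left; exists (projT1 (cid ex)) => //; exact: projT2 (cid ex).
right; split=> // a Aap; pose V := [set `|y b| | b in [set b | A b p]].
have hV : has_sup V.
  split; first by exists `|y a|; exists a.
  by case: by_ => M /ubP yM; exists M => _ [b _ <-]; apply: yM; exists b.
have leV b : A b p -> `|y b| <= sup V.
  by move=> Abp; apply: ub_le_sup; [case: hV|exists b].
apply: nex; have [V0|V0] := ltP 0 (sup V); last first.
  by exists a; split=> // b /leV byV; rewrite (le_trans byV)// (le_trans V0).
have [_ [b Abp <-] Vb] := sup_adherent (divr_gt0 V0 (ltr0n R 2)) hV.
exists b; split=> // c /leV cV; rewrite (le_trans cV)//.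
by move: Vb; lra.
Qed.

Lemma spread_le y p M : 0 <= M -> (forall a, `|y a| <= M) -> `|spread y p| <= M.
Proof.
by move=> M0 yM; rewrite /spread; case: pselect => [?|_]; rewrite ?normr0.
Qed.

Lemma spread_delta y a p : (forall b, b <> a -> y b = 0) -> A a p ->
  spread y p = y a.
Proof.
move=> ya Aap; have yb : sup_bounded y.
  exists `|y a| => _ [b _ <-]; have [->//|/ya ->] := pselect (b = a).
  by rewrite normr0.
have [[b [_ dom] ->]|[/(_ a)//]] := spreadP p yb.
have [->//|ba] := pselect (b = a); have := dom a Aap.
by rewrite (ya b ba) normr0 mulr0 normr_le0 => /eqP ->.
Qed.

(** Off the finitely many points where two sets of index in [S] meet, at most one [a] in [S] has
    [A a p]; take evaluation at [a] for [l], or 0 if there is none. A dominant index other than [a]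
    lies outside [S], so its value is below [e], which forces [y a] below [2 * e]. *)
Lemma spread_approx (S : set I) (e : R) : almost_disjoint A -> finite_set S ->
  0 < e -> exists2 N : set nat, finite_set N & forall p, ~ N p ->
    exists2 l : (I -> R) -> R,
      (forall c y z, l (fun a => c * y a + z a) = c * l y + l z) &
      forall y, sup_bounded y -> [set a | e <= `|y a|] `<=` S ->
        `|spread y p - l y| < 3 * e.
Proof.
move=> disA finS e0.
exists (\bigcup_(a in S) \bigcup_(b in S `\ a) (A a `&` A b)).
  apply: bigcup_finite => // a _; apply: bigcup_finite; first exact: finite_setD.
  by move=> b [_ ba]; apply: disA => ab; exact: ba.
move=> p Np; have [[a [Sa Aap]]|nS] := pselect (exists a, S a /\ A a p).
  exists (fun y => y a) => // y yb yS.
  have [[b [Abp dom] ->]|[/(_ a)//]] := spreadP p yb.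
  have [->|ba] := pselect (b = a); first by rewrite subrr normr0 mulr_gt0.
  have yb_lt : `|y b| < e.
    rewrite ltNge; apply/negP => /yS Sb.
    by apply: Np; exists a => //; exists b.
  have yab := dom a Aap; rewrite (le_lt_trans (ler_normB _ _))//; lra.
exists (fun=> 0) => [c _ _|y yb yS]; first by rewrite mulr0 addr0.
rewrite subr0; have [[b [Abp dom] ->]|[_ ->]] := spreadP p yb; last first.
  by rewrite normr0 mulr_gt0.
rewrite (@lt_le_trans _ _ e)//; last by rewrite ler_peMl// ?ler1n// ltW.
rewrite ltNge; apply/negP => /yS Sb; apply: nS; by exists b.
Qed.

Lemma spread_linear (c : R) y z : almost_disjoint A -> in_c0 y -> in_c0 z ->
  in_c0 (fun p => spread (fun a => c * y a + z a) p - (c * spread y p + spread z p)).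
Proof.
move=> disA yc zc e e0.
(* The three approximation errors, weighted by 1, [|c|] and 1, total [3 * d * (|c| + 2) = e]. *)
pose w a := c * y a + z a; pose d := e / (3 * (`|c| + 2)).
have c2 : 0 < `|c| + 2 by rewrite ltr_wpDl.
have d0 : 0 < d by rewrite divr_gt0// mulr_gt0.
have wc : in_c0 w := in_c0D (in_c0Z c yc) zc.
have bnd (u : I -> R) : in_c0 u -> sup_bounded u.
  by move=> uc; exact: c0val_bounded (C0Mk uc).
(* A common [S] for the three sequences gives one linear [l] for all of them, and the values of [l]
   cancel. *)
pose S := [set a | d <= `|y a|] `|` [set a | d <= `|z a|] `|` [set a | d <= `|w a|].
have finS : finite_set S.
  rewrite !finite_setU; split; last exact: wc.
  by split; [exact: yc|exact: zc].
have [N finN Np] := spread_approx disA finS d0.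
apply: sub_finite_set finN => p /=; apply: contraPP => /Np[l lin lE].
have yl : `|spread y p - l y| < 3 * d.
  by apply: (lE _ (bnd _ yc)) => a; left; left.
have zl : `|spread z p - l z| < 3 * d.
  by apply: (lE _ (bnd _ zc)) => a; left; right.
have wl : `|spread w p - l w| < 3 * d by apply: (lE _ (bnd _ wc)) => a; right.
apply/negP; rewrite -ltNge -/w.
have -> : spread w p - (c * spread y p + spread z p) =
    (spread w p - l w) - (c * (spread y p - l y) + (spread z p - l z)).
  by rewrite lin; ring.
rewrite (le_lt_trans (ler_normB _ _))//.
rewrite (le_lt_trans (lerD (lexx _) (ler_normD _ _)))// normrM.
have : `|c| * `|spread y p - l y| <= `|c| * (3 * d) by rewrite ler_wpM2l// ltW.
have : e = 3 * d + (`|c| * (3 * d) + 3 * d) by rewrite /d; field; rewrite gt_eqF.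
by lra.
Qed.

End spread.

(** * Bounded operators, exactness and splittings of the twisted sum *)

Lemma linear_le_continuous (R : realType) (V W : normedModType R)
    (h : {linear V -> W}) (M : R) : (forall v, `|h v| <= M * `|v|) -> continuous h.
Proof.
move=> hM; apply/bounded_linear_continuous/linear_boundedP.
near=> r => v; rewrite (le_trans (hM v))// ler_wpM2r//; near: r.
Unshelve. all: by end_near. Qed.

Lemma continuous_linear_le (R : realType) (V W : normedModType R)
    (h : {linear V -> W}) : continuous h ->
  exists2 M, 0 <= M & forall v, `|h v| <= M * `|v|.
Proof.
move=> /linear_bounded_continuous/linear_boundedP/pinfty_ex_gt0[M M0 hM].
by exists M => //; exact: ltW.
Qed.

Section twist_exact.
Context {R : realType} {X : completeNormedModType R} {Phi : X -> nat -> R}.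
Variable linPhi : c0_linear Phi.
Local Notation Z := (twist linPhi).

Let incl_subproof (w : c0 R nat) : in_c0 (fun p => c0val w p - Phi 0 p).
Proof.
by apply: eq_in_c0 (c0valP w) => p; rewrite (c0_linear0 p linPhi) subr0.
Qed.

Definition twist_incl (w : c0 R nat) : Z := Twist linPhi (incl_subproof w).

Let incl_linear : linear twist_incl.
Proof. by move=> a u v; apply: twist_inj => //=; rewrite scaler0 addr0. Qed.

HB.instance Definition _ :=
  GRing.isLinear.Build R (c0 R nat) Z *:%R twist_incl incl_linear.

Let base_linear : linear (base : Z -> X).
Proof. by []. Qed.

HB.instance Definition _ :=
  GRing.isLinear.Build R Z X *:%R (base : Z -> X) base_linear.

Let section_subproof (x : X) : in_c0 (fun p => Phi x p - Phi x p).
Proof. by apply: eq_in_c0 (c0valP (0 : c0 R nat)) => p; rewrite subrr. Qed.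

(** A bounded right inverse of [base], in general not linear. *)
Definition twist_section (x : X) : Z := Twist linPhi (section_subproof x).

Lemma twist_section_le : exists2 M, 0 <= M & forall x, `|twist_section x| <= M * `|x|.
Proof.
have [M M0 PhiM] := c0_linear_bound linPhi; exists (M + 1).
  by rewrite addr_ge0.
move=> x; apply: twist_norm_le => [|p] /=.
  by rewrite ler_peMl// lerDr.
by rewrite (le_trans (PhiM x p))// ler_wpM2r// lerDl.
Qed.

Lemma twist_exact : twisted_sum (twist_incl : {linear c0 R nat -> Z})
  (base : {linear Z -> X}).
Proof.
split.
- apply: (@linear_le_continuous _ _ _ _ 1) => w; rewrite mul1r.
  apply: twist_norm_le => [|p] /=; first by rewrite normr0.
  by rewrite c0normE supnorm_ub//; exact: c0val_bounded.
- by apply: (@linear_le_continuous _ _ _ _ 1) => u; rewrite mul1r base_le.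
- move=> v w /(congr1 fiber) vw; apply: c0val_inj => p.
  by rewrite -[LHS]/(fiber (twist_incl v) p) vw.
- apply/seteqP; split=> [_ [w _ <-]//|u /= u0].
  have uc : in_c0 (fiber u).
    by apply: eq_in_c0 (fiberP u) => p; rewrite u0 (c0_linear0 p linPhi) subr0.
  by exists (C0Mk uc) => //; apply: twist_inj.
- by apply/seteqP; split=> // x _; exists (twist_section x).
Qed.

(* Subtracting the retraction from the fiber gives functionals that vanish on
   the copy of [c_0], hence depend only on the base. *)
Lemma twist_split : trivial_twisted_sum (twist_incl : {linear c0 R nat -> Z}) ->
  exists (sigma : nat -> {linear X -> R}) (M : R),
    (forall p x, `|sigma p x| <= M * `|x|) /\
    forall x, in_c0 (fun p => Phi x p - sigma p x).
Proof.
move=> [r [/continuous_linear_le[M M0 rM] rK]].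
pose s p (x : X) : R := fiber (twist_section x) p - c0val (r (twist_section x)) p.
have sE p u : fiber u p - c0val (r u) p = s p (base u).
  pose w : Z := u - twist_section (base u).
  have [v wE] : exists v, twist_incl v = w.
    have [_ _ _ /seteqP[_ /(_ w) H] _] := twist_exact.
    by have [|v _ <-] := H; [rewrite /= subrr|exists v].
  have rw_w : c0val (r u - r (twist_section (base u))) p = fiber w p.
    by rewrite -linearB -/w -wE rK.
  suff : c0val (r u) p - c0val (r (twist_section (base u))) p =
    fiber u p - fiber (twist_section (base u)) p by rewrite /s; lra.
  exact: rw_w.
have sl p : linear (s p).
  move=> a x y.
  (* By [sE], [s p] may be computed at any lift of its argument; this lift makes linearity
     visible. *)
  rewrite -(sE p (a *: twist_section x + twist_section y)) linearP /= /s.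
  by rewrite /GRing.scale /=; ring.
pose sigma p : {linear X -> R} := HB.pack (s p)
  (GRing.isLinear.Build R X R *:%R (s p) (sl p)).
have [N N0 secN] := twist_section_le.
exists sigma, ((1 + M) * N); split=> [p x|x].
  rewrite /= /s (le_trans (ler_normB _ _))// -mulrA mulrDl mul1r lerD//.
    by rewrite (le_trans (fiber_le _ p)).
  rewrite (le_trans _ (ler_wpM2l M0 (secN x)))// (le_trans _ (rM _))//.
  by rewrite c0normE supnorm_ub//; exact: c0val_bounded.
by apply: eq_in_c0 (c0valP (r (twist_section x))) => p /=; rewrite /s /= subKr.
Qed.

End twist_exact.

(** * Nontrivial twisted sums from biorthogonal systems *)

Lemma Ext_c0_neq0 (R : realType) (X : completeNormedModType R)
    (f : nat * continuum -> X) (g : nat * continuum -> {linear X -> R}) (M C : R) :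
  (forall i, g i (f i) = 1) -> (forall i j, i <> j -> g i (f j) = 0) ->
  (forall i x, `|g i x| <= M * `|x|) -> weak_star_null g ->
  (forall (a : nat -> continuum) N, `|\sum_(n < N) f (val n, a n)| <= C) ->
  Ext_neq0 X (c0 R nat).
Proof.
move=> gf1 gf0 gM g0 fC; have [A [nu [disA sepA]]] := unseparated_family.
pose y x a := g (nu a, a) x.
have yc x : in_c0 (y x).
  move=> e e0; apply: sub_finite_set (finite_image snd (g0 x e e0)) => a /= ya.
  by exists (nu a, a).
pose Phi x := spread A (y x).
have linPhi : c0_linear Phi.
  split.
  - exists (Num.max M 0); first by rewrite le_max lexx orbT.
    move=> x p; apply: spread_le => [|a].
      by rewrite mulr_ge0// le_max lexx orbT.
    by rewrite (le_trans (gM _ _))// ler_wpM2r// le_max lexx.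
  - move=> u v; apply: eq_in_c0 (spread_linear 1 disA (yc u) (yc v)) => p.
    rewrite mul1r; congr (spread _ _ _ - _); apply/funext => a.
    by rewrite mul1r /y linearD.
  - move=> c u; apply: eq_in_c0 (spread_linear c disA (yc u) (yc 0)) => p.
    have -> : spread A (y 0) p = 0.
      apply/eqP; rewrite -normr_le0; apply: spread_le => // a.
      by rewrite /y linear0 normr0.
    rewrite addr0; congr (spread _ _ _ - _); apply/funext => a.
    by rewrite /y linear0 addr0 linearZ.
exists (twist linPhi), (twist_incl linPhi), base; split; first exact: twist_exact.
move=> /twist_split[sigma [D [sD sP]]].
pose B n := [set p | exists a, 2^-1 <= sigma p (f (n, a))].
(* On [A a], [Phi (f (nu a, a))] is 1, since [y] sends this vector to the unit vector at [a];
   [sigma] agrees with it modulo [c_0]. *)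
have AB a : finite_set (A a `\` B (nu a)).
  have e0 : 0 < 2^-1 :> R by rewrite invr_gt0.
  apply: sub_finite_set (sP (f (nu a, a)) _ e0) => p [Aap nB] /=.
  have -> : Phi (f (nu a, a)) p = 1.
    rewrite /Phi (spread_delta _ Aap); first exact: gf1.
    by move=> b ba; apply: gf0 => -[_ ab]; exact: ba.
  have sp : sigma p (f (nu a, a)) < 2^-1.
    by rewrite ltNge; apply/negP => sp; apply: nB; exists a.
  by rewrite ger0_norm; lra.
(* So many values of at least 1/2 sum to more than [Num.max D 0 * C], the bound for [sigma p] on the
   sum of the vectors. *)
pose K := (Num.truncn (2 * (Num.max D 0 * C))).+1.
have [p pB] := sepA B AB K.
have /choice[a aB] : forall n, exists a, (n < K)%N -> 2^-1 <= sigma p (f (n, a)).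
  move=> n; have [nK|nK] := boolP (n < K)%N; last by exists point.
  by have [a ?] := pB n nK; exists a.
have : K%:R * 2^-1 <= sigma p (\sum_(n < K) f (val n, a n)).
  rewrite linear_sum /= mulr_natl -[K in leLHS]card_ord -sumr_const.
  by apply: ler_sum => n _; exact: aB.
rewrite leNgt => /negP; apply.
rewrite (le_lt_trans (ler_norm _))// (le_lt_trans (sD _ _))//.
apply: (@le_lt_trans _ _ (Num.max D 0 * C)).
  apply: (@le_trans _ _ (Num.max D 0 * `|\sum_(n < K) f (val n, a n)|)).
    by rewrite ler_wpM2r// le_max lexx.
  by rewrite ler_wpM2l// le_max lexx orbT.
rewrite ltr_pdivlMr// mulrC; exact: truncnS_gt.
Qed.

(** Continuity bounds the set defining [opnorm h], so its supremum is not a default value; then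
    rescale [v] to norm 1. *)
Lemma opnorm_le (R : realType) (X : normedModType R) (h : {linear X -> R}) v :
  continuous h -> `|h v| <= opnorm h * `|v|.
Proof.
move=> /continuous_linear_le[M M0 hM].
have [->|v0] := eqVneq v 0; first by rewrite linear0 !normr0 mulr0.
have nv0 : 0 < `|v| by rewrite normr_gt0.
have {1}-> : v = `|v| *: (`|v|^-1 *: v) by rewrite scalerA divff ?scale1r ?gt_eqF.
rewrite linearZ normrM normr_id mulrC ler_wpM2r//.
apply: ub_le_sup.
  exists M => _ [w /= w1 <-]; rewrite (le_trans (hM w))//.
  by rewrite ler_piMr.
exists (`|v|^-1 *: v) => //=.
by rewrite normrZ ger0_norm ?invr_ge0// mulVf ?gt_eqF.
Qed.

(** * Bump functions on separated closed sets *)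

Section disjoint_bumps.
Context {R : realType} {K : topologicalType}.
Hypothesis normalK : normal_space K.

(** Urysohn functions [u n], equal to 1 on [F n] and 0 on the other sets, are multiplied by the
    product of the earlier [1 - u m]. This changes nothing on [F n], and the sums telescope to
    [1 - P N x]. *)
Lemma subpartition_of_unity (F : nat -> set K) :
  (forall n, closed (F n)) ->
  (forall n, F n `&` closure (\bigcup_(m in [set m | m <> n]) F m) = set0) ->
  exists phi : nat -> K -> R,
    [/\ forall n, continuous (phi n), forall n x, 0 <= phi n x,
        forall n x, F n x -> phi n x = 1
      & forall N x, \sum_(n < N) phi n x <= 1].
Proof.
move=> clF disF.
have /choice[u uP] n : exists u : K -> R, [/\ continuous u,
    u @` closure (\bigcup_(m in [set m | m <> n]) F m) `<=` [set 0],
    u @` F n `<=` [set 1] & range u `<=` `[0, 1]].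
  apply: urysohn_ext_itv => //; first exact: closed_closure.
  by rewrite setIC disF.
have u01 n x : 0 <= u n x <= 1.
  have [_ _ _ /(_ (u n x))] := uP n.
  by rewrite /= in_itv /=; apply; exists x.
have u1 n x : F n x -> u n x = 1.
  by move=> Fx; have [_ _ /(_ (u n x)) H _] := uP n; apply: H; exists x.
have u0 n m x : m <> n -> F m x -> u n x = 0.
  move=> mn Fx; have [_ /(_ (u n x)) H _ _] := uP n; apply: H; exists x => //.
  by apply: subset_closure; exists m.
pose P N x : R := \prod_(n < N) (1 - u n x).
have P0 N x : 0 <= P N x.
  by apply: prodr_ge0 => n _; rewrite subr_ge0; case/andP: (u01 n x).
have P_cont N : continuous (P N).
  rewrite /P; elim: N => [|N IH] x.
    by under eq_fun do rewrite big_ord0; exact: cvg_cst.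
  under eq_fun do rewrite big_ord_recr /=.
  apply: cvgM; first exact: IH.
  by apply: cvgB; [exact: cvg_cst|have [+ _ _ _] := uP N; exact].
exists (fun n x => u n x * P n x); split.
- by move=> n x; apply: cvgM; [have [+ _ _ _] := uP n; exact|exact: P_cont].
- by move=> n x; rewrite mulr_ge0//; case/andP: (u01 n x).
- move=> n x Fx; rewrite u1// mul1r /P big1// => m _.
  rewrite (@u0 m n) ?subr0// => nm.
  by have := ltn_ord m; rewrite -nm ltnn.
- move=> N x; suff -> : \sum_(n < N) u n x * P n x = 1 - P N x.
    by rewrite gerBl.
  rewrite /P; elim: N => [|N IH]; first by rewrite !big_ord0 subrr.
  by rewrite !big_ord_recr /= IH; ring.
Qed.

End disjoint_bumps.

(** * Transfer from the subspace to the whole compact space *)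

Section embedding.
Context {R : realType} {L K : topologicalType} (j : L -> K).
Hypotheses (cL : compact [set: L]) (cK : compact [set: K]).
Hypotheses (hK : hausdorff_space K) (cj : continuous j) (injj : injective j).

Lemma embedding_closed (B : set L) : closed B -> closed (j @` B).
Proof.
move=> clB; apply: compact_closed => //; apply: continuous_compact.
  exact: continuous_subspaceT.
by apply: subclosed_compact cL _.
Qed.

Lemma embedding_separated (F : nat -> set L) n :
  F n `&` closure (\bigcup_(m in [set m | m <> n]) F m) = set0 ->
  j @` F n `&` closure (\bigcup_(m in [set m | m <> n]) j @` F m) = set0.
Proof.
move=> dis; rewrite -subset0 => _ [[x Fx <-] cx].
have : (j @` closure (\bigcup_(m in [set m | m <> n]) F m)) (j x).
  have := embedding_closed (@closed_closure _ (\bigcup_(m in [set m | m <> n]) F m)).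
  move=> /closure_id ->; apply: closureS cx => _ [m mn [z Fz <-]].
  by exists z => //; apply: subset_closure; exists m.
move=> [z cz /injj zx]; rewrite zx in cz.
by have : (F n `&` closure (\bigcup_(m in [set m | m <> n]) F m)) x by []; rewrite dis.
Qed.

(** Carried over to the closed set [range j], [f] stays continuous because [j] is a closed map;
    Tietze's theorem extends it with the same bound. *)
Lemma embedding_extension (f : L -> R) M : 0 < M -> continuous f ->
  (forall x, `|f x| <= M) ->
  exists g : K -> R, [/\ continuous g, forall x, g (j x) = f x
    & forall y, `|g y| <= M].
Proof.
move=> M0 cf fM.
have [f' f'j] : exists f' : K -> R, forall x, f' (j x) = f x.
  exists (fun y => if pselect (exists x, j x = y) is left ex
    then f (projT1 (cid ex)) else 0) => x.
  case: pselect => [ex|[]]; last by exists x.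
  by congr f; apply: injj; exact: projT2 (cid ex).
have clj : closed (range j) by exact/embedding_closed/closedT.
have cf' : {within range j, continuous f'}.
  apply/continuous_closedP => D clD; apply/closed_subspaceP.
  exists (j @` (f @^-1` D)).
    by apply: embedding_closed; apply: closed_comp => // x _; exact: cf.
  apply/seteqP; split=> [_ [[x Dx <-] rx]|y [Dx [x _ xE]]].
    by split=> //; rewrite /preimage /from_subspace /= f'j.
  by subst y; split; exists x => //=; rewrite -f'j.
have [|g [gE cg gM]] :=
    continuous_bounded_extension (compact_normal hK cK) clj M0 cf' _.
  by move=> _ [x _ <-]; rewrite f'j.
exists g; split=> // x; rewrite -f'j gE// inE; by exists x.
Qed.

Definition Crestrict (v : Cspace R cK) : Cspace R cL :=
  Cmk (fun x => continuous_comp (@cj x) (@Cval_continuous R K cK v (j x))).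

Lemma Crestrict_linear : linear Crestrict.
Proof. by move=> a u v; apply: Cval_inj. Qed.

HB.instance Definition _ := GRing.isLinear.Build R (Cspace R cK) (Cspace R cL)
  *:%R Crestrict Crestrict_linear.

Lemma Crestrict_le v : `|Crestrict v| <= `|v|.
Proof.
rewrite !CnormE; apply: supnorm_le => [|x]; first exact: supnorm_ge0.
exact: (@supnorm_ub _ _ (Cval v)) (Cval_bounded v).
Qed.

Lemma Ext_c0_embedding : property_star R cL -> Ext_neq0 (Cspace R cK) (c0 R nat).
Proof.
move=> [F [f [g [[clF [gc gf1 gf0] [[M /ubP fM] [N /ubP gN]] gnull] [disF suppF]]]]].
have [phi [cphi phi0 phi1 phiS]] := @subpartition_of_unity R K
  (compact_normal hK cK) (fun n => j @` F n)
  (fun n => embedding_closed (clF n)) (fun n => embedding_separated (disF n)).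
(* The extension lemma asks for a positive bound. *)
pose C := Num.max M 1.
have C0 : 0 < C by rewrite lt_max ltr01 orbT.
have /choice[e eP] i : exists e : K -> R, [/\ continuous e,
    forall x, e (j x) = Cval (f i) x & forall y, `|e y| <= C].
  apply: embedding_extension => //; first exact: Cval_continuous.
  move=> x; rewrite (le_trans (supnorm_ub x (Cval_bounded (f i))))//.
  by rewrite -CnormE le_max fM//; exists i.
have ce i : continuous (fun y => phi i.1 y * e i y).
  by move=> y; apply: cvgM; [exact: cphi|have [+ _ _] := eP i; exact].
pose fK i : Cspace R cK := Cmk (ce i).
(* The factor [phi n] is invisible on the copy of [L]: it is 1 on the image of [F n], and [f (n, a)]
   vanishes elsewhere. *)
have fKf i : Crestrict (fK i) = f i.
  apply: Cval_inj => x; rewrite -[LHS]/(phi i.1 (j x) * e i (j x)).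
  have [_ -> _] := eP i; have [->|fx] := eqVneq (Cval (f i) x) 0.
    by rewrite mulr0.
  rewrite phi1 ?mul1r//; exists x => //.
  by case: i fx => n a fx; apply: (suppF n a); exact: subset_closure.
apply: (@Ext_c0_neq0 R (Cspace R cK) fK
  (fun i => g i \o Crestrict : {linear _ -> _}) N C).
- by move=> i /=; rewrite fKf.
- by move=> i k /= ik; rewrite fKf gf0.
- move=> i v /=; rewrite (le_trans (opnorm_le _ (gc i)))//.
  apply: (@le_trans _ _ (opnorm (g i) * `|v|)).
    rewrite ler_wpM2l ?Crestrict_le//.
    (* Nonnegativity of [opnorm (g i)] follows from [1 <= opnorm (g i) * |f i|]. *)
    have := opnorm_le (f i) (gc i); rewrite gf1 normr1 => h.
    by rewrite leNgt; apply/negP => o0; have := normr_ge0 (f i); nra.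
  by rewrite ler_wpM2r// gN//; exists i.
- by move=> v; exact: gnull (Crestrict v).
move=> a n; rewrite CnormE; apply: supnorm_le => [|y]; first exact: ltW.
have -> : Cval (\sum_(m < n) fK (val m, a m)) y =
    \sum_(m < n) phi m y * e (val m, a m) y.
  by elim/big_rec2 : _ => // m s v _ <-.
rewrite (le_trans (ler_norm_sum _ _ _))//.
(* The extensions may overlap off the copy of [L], but at each [y] their weights [phi m y] sum to at
   most 1. *)
apply: (@le_trans _ _ (\sum_(m < n) phi m y * C)).
  apply: ler_sum => m _; rewrite normrM ger0_norm// ler_wpM2l//.
  by have [_ _] := eP (val m, a m); exact.
by rewrite -mulr_suml ler_piMl// ltW.
Qed.

End embedding.

Theorem theorem2p7 (R : realType) (L : topologicalType)
    (compactL : compact [set: L]) (hausdorffL : hausdorff_space L)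
    (starL : property_star R compactL)
    (K : topologicalType)
    (compactK : compact [set: K]) (hausdorffK : hausdorff_space K)
    (copyLK : contains_copy K L) :
  Ext_neq0 (Cspace R compactK) (c0 R nat).
Proof.
have [A [h [k [ch _ hk _]]]] := copyLK.
have cj : continuous (fun x => set_val (h x)).
  move=> x; apply: continuous_comp; first exact: ch.
  exact: initial_continuous.
by apply: Ext_c0_embedding cj _ starL => // x y /val_inj/(can_inj hk).
Qed.
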